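(* Let $\mathcal{C}$ be a Melnikov formation of finite groups and let $(\Gamma,\Lambda)$ be a $\mathcal{C}$-projective pair. Consider a pro-$\mathcal{C}$-DEP for $(\Gamma,\Lambda)$, given by pro-$\mathcal{C}$ groups $A\le B$ and $G\le H$ and epimorphisms $\mu\colon\Gamma\to A$, $\alpha\colon G\to A$, $\nu\colon\Lambda\to B$, $\beta\colon H\to B$ with $\nu|_\Gamma=\mu$ and $\beta|_G=\alpha$. Then any weak solution $\eta\colon\Gamma\to G$ of the lower embedding problem $(\mu,\alpha)$ (i.e. any homomorphism $\eta$ with $\alpha\eta=\mu$) can be lifted to a weak solution $(\eta,\theta)$ of the pro-$\mathcal{C}$-DEP; that is, there is a homomorphism $\theta\colon\Lambda\to H$ with $\beta\theta=\nu$ and $\theta|_\Gamma=\eta$.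
   Context: A Melnikov formation $\mathcal{C}$ is a family of finite groups closed under fiber products (with respect to epimorphisms) and such that for every short exact sequence $1\to A\to B\to C\to 1$ one has $A,C\in\mathcal{C}$ if and only if $B\in\mathcal{C}$. A pro-$\mathcal{C}$ group is a profinite group all of whose finite continuous quotients are in $\mathcal{C}$. All subgroups of profinite groups are closed and all homomorphisms are continuous. Let $\Gamma\le\Lambda$ be pro-$\mathcal{C}$ groups. A pro-$\mathcal{C}$-DEP for $(\Gamma,\Lambda)$ consists of pro-$\mathcal{C}$ groups $A\le B$ and $G\le H$ and epimorphisms $\mu\colon\Gamma\to A$, $\alpha\colon G\to A$, $\nu\colon\Lambda\to B$, $\beta\colon H\to B$ such that $\nu|_\Gamma=\mu$ and $\beta|_G=\alpha$; it is called a $\mathcal{C}$-DEP if $G,H,A,B\in\mathcal{C}$ (so they are finite). A weak solution is a pair $(\eta,\theta)$ of homomorphisms $\eta\colon\Gamma\to G$, $\theta\colon\Lambda\to H$ (not necessarily surjective) with $\alpha\eta=\mu$, $\beta\theta=\nu$ and $\theta|_\Gamma=\eta$. The pair $(\Gamma,\Lambda)$ is $\mathcal{C}$-projective if every $\mathcal{C}$-DEP for it has a weak solution. *)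

(* Defs.v *)
From HB Require Import structures.
From mathcomp Require Import all_boot all_order all_fingroup.
From mathcomp Require Import all_classical topology.

Set Implicit Arguments.
Unset Strict Implicit.
Unset Printing Implicit Defensive.

Local Open Scope group_scope.

Section FiberProduct.
Variables (B1 B2 A : finGroupType) (f : B1 -> A) (g : B2 -> A).
Hypotheses (fM : {morph f : x y / x * y}) (gM : {morph g : x y / x * y}).

Definition fiber_set : {set B1 * B2} := [set u | f u.1 == g u.2]%SET.

Lemma fiber_group_set : group_set fiber_set.
Proof.
have f1 : f 1 = 1 by apply: (@mulgI _ (f 1)); rewrite -fM !mulg1.
have g1 : g 1 = 1 by apply: (@mulgI _ (g 1)); rewrite -gM !mulg1.
apply/group_setP; split=> [|u v]; first by rewrite inE /= f1 g1.
by rewrite !inE /= fM gM => /eqP -> /eqP ->.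
Qed.

Definition fiber_group : {group B1 * B2} := Group fiber_group_set.
End FiberProduct.

Definition surjective (T U : Type) (f : T -> U) : Prop :=
  forall y, exists x, f x = y.

Definition short_exact (A B C : groupType) (i : A -> B) (p : B -> C) : Prop :=
  [/\ {morph i : x y / x * y}, {morph p : x y / x * y},
      injective i, surjective p
    & forall b, p b = 1 <-> exists a, i a = b].

(* Closure of F under isomorphism is the instance A = 1 of the condition on
   short exact sequences. *)
Record melnikov_formation (F : finGroupType -> Prop) : Prop := {
  melnikov_fiber (B1 B2 A : finGroupType) (f : B1 -> A) (g : B2 -> A)
    (fM : {morph f : x y / x * y}) (gM : {morph g : x y / x * y}) :
    surjective f -> surjective g -> F B1 -> F B2 -> F A ->
    F [subg fiber_group fM gM]%type ;
  melnikov_exact (A B C : finGroupType) (i : A -> B) (p : B -> C) :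
    short_exact i p -> F A /\ F C <-> F B
}.

Local Open Scope classical_set_scope.

HB.mixin Record isTopologicalGroup G of Topological G & monoid.Group G := {
  mulg_continuous : continuous (fun x : G * G => (x.1 * x.2 : G)) ;
  invg_continuous : continuous (fun x : G => (x^-1 : G))
}.

#[short(type="topologicalGroupType")]
HB.structure Definition TopologicalGroup :=
  {G of Topological G & monoid.Group G & isTopologicalGroup G}.

HB.mixin Record isProfinite G of TopologicalGroup G := {
  profinite_compact : compact [set: G] ;
  profinite_hausdorff : hausdorff_space G ;
  profinite_disconnected : totally_disconnected [set: G]
}.

#[short(type="profiniteGroupType")]
HB.structure Definition ProfiniteGroup := {G of TopologicalGroup G & isProfinite G}.

Record closedSubgroup (P : profiniteGroupType) := ClosedSubgroup {
  subgroup_set :> set P ;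
  subgroup_closed : closed subgroup_set ;
  subgroup1 : subgroup_set 1 ;
  subgroupM : forall x y, subgroup_set x -> subgroup_set y -> subgroup_set (x * y) ;
  subgroupV : forall x, subgroup_set x -> subgroup_set x^-1
}.

Section SubgroupInstances.
Variables (P : profiniteGroupType) (S : closedSubgroup P).
Local Notation T := (set_type (subgroup_set S)).

Definition subgroup_one : T := SigSub (mem_set (subgroup1 S)).
Definition subgroup_mul (x y : T) : T :=
  SigSub (mem_set (subgroupM (set_valP x) (set_valP y))).
Definition subgroup_inv (x : T) : T :=
  SigSub (mem_set (subgroupV (set_valP x))).

Lemma subgroup_mulA : associative subgroup_mul.
Proof. by move=> x y z; apply: val_inj; rewrite /= mulgA. Qed.
Lemma subgroup_mul1 : left_id subgroup_one subgroup_mul.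
Proof. by move=> x; apply: val_inj; rewrite /= mul1g. Qed.
Lemma subgroup_mulr1 : right_id subgroup_one subgroup_mul.
Proof. by move=> x; apply: val_inj; rewrite /= mulg1. Qed.
Lemma subgroup_mulV : left_inverse subgroup_one subgroup_inv subgroup_mul.
Proof. by move=> x; apply: val_inj; rewrite /= mulVg. Qed.
Lemma subgroup_mulrV : right_inverse subgroup_one subgroup_inv subgroup_mul.
Proof. by move=> x; apply: val_inj; rewrite /= mulgV. Qed.

HB.instance Definition _ := isGroup.Build T subgroup_mulA subgroup_mul1
  subgroup_mulr1 subgroup_mulV subgroup_mulrV.

Lemma subgroup_val_continuous : continuous (set_val : T -> P).
Proof. exact: initial_continuous. Qed.

Lemma subgroup_continuous (U : topologicalType) (f : U -> T) :
  continuous (set_val \o f : U -> P) -> continuous f.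
Proof. by move=> cf; apply/continuous_comp_initial. Qed.

Lemma subgroup_mul_continuous :
  continuous (fun x : T * T => (x.1 * x.2 : T)).
Proof.
apply: subgroup_continuous => -[x y] /=.
apply: (@continuous2_cvg _ P P P _ _ _ _ (fun a b : P => a * b)).
- exact: (@mulg_continuous P (set_val x, set_val y)).
- by apply: cvg_comp; [exact: cvg_fst | exact: subgroup_val_continuous].
- by apply: cvg_comp; [exact: cvg_snd | exact: subgroup_val_continuous].
Qed.

Lemma subgroup_inv_continuous : continuous (fun x : T => (x^-1 : T)).
Proof.
apply: subgroup_continuous => x /=.
apply: (@continuous_comp _ _ _ (set_val : T -> P) (fun a : P => a^-1)).
  exact: subgroup_val_continuous.
exact: invg_continuous.
Qed.

HB.instance Definition _ := isTopologicalGroup.Build T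
  subgroup_mul_continuous subgroup_inv_continuous.

Lemma subgroup_compact : compact [set: T].
Proof.
move=> F FF _.
have cS : compact S.
  by apply: (subclosed_compact _ (@profinite_compact P)) => //; exact: subgroup_closed.
have [|p [Sp clp]] := cS (set_val @ F) _.
  by apply: (@filterS _ F _ setT) => [x _|]; [exact: set_valP | exact: filterT].
exists (SigSub (mem_set Sp)); split=> // A B FA [_ [[W oW <-] Wp WB]].
have [||_ [[a Aa <-] Wa]] := clp (set_val @` A) W.
- by apply: (@filterS _ F _ A) => // x Ax; exists x.
- exact: open_nbhs_nbhs.
- by exists a; split=> //; exact: WB.
Qed.

Lemma subgroup_hausdorff : hausdorff_space T.
Proof.
move=> p q pq; apply: val_inj; apply: (@profinite_hausdorff P) => A B nA nB.
have [||x [Ax Bx]] := pq (set_val @^-1` A) (set_val @^-1` B).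
- exact: subgroup_val_continuous.
- exact: subgroup_val_continuous.
- by exists (set_val x).
Qed.

Lemma subgroup_disconnected : totally_disconnected [set: T].
Proof.
move=> x _; apply/seteqP; split=> [y [C [Cx _ cC] Cy]|_ ->]; last first.
  exact: connected_component_refl.
have cvC : connected (set_val @` C).
  apply: connected_continuous_connected => //.
  by apply: continuous_subspaceT; exact: subgroup_val_continuous.
have : connected_component [set: P] (set_val x) (set_val y).
  by exists (set_val @` C); [split=> //; exists x | exists y].
by rewrite profinite_disconnected // => /val_inj.
Qed.

HB.instance Definition _ := isProfinite.Build T
  subgroup_compact subgroup_hausdorff subgroup_disconnected.

End SubgroupInstances.

Definition hom (G H : topologicalGroupType) (f : G -> H) : Prop :=
  {morph f : x y / x * y} /\ continuous f.

Definition epi (G H : topologicalGroupType) (f : G -> H) : Prop :=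
  hom f /\ surjective f.

(* F is a family of abstract finite groups. A member of F seen as a profinite
   group carries the discrete topology, the only Hausdorff one on a finite set. *)
Definition member (F : finGroupType -> Prop) (G : profiniteGroupType) : Prop :=
  exists K : finGroupType, F K /\
    exists f : G -> K, {morph f : x y / x * y} /\ bijective f.

Definition pro (F : finGroupType -> Prop) (G : profiniteGroupType) : Prop :=
  forall (K : finGroupType) (f : G -> K),
    {morph f : x y / x * y} -> continuous (f : G -> discrete_topology K) ->
    surjective f -> F K.

Record proDEP (F : finGroupType -> Prop) (L : profiniteGroupType)
    (Gam : closedSubgroup L) := ProDEP {
  depB : profiniteGroupType ;
  depA : closedSubgroup depB ;
  depH : profiniteGroupType ;
  depG : closedSubgroup depH ;
  depB_pro : pro F depB ;
  depA_pro : pro F depA ;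
  depH_pro : pro F depH ;
  depG_pro : pro F depG ;
  dep_mu : Gam -> depA ;
  dep_alpha : depG -> depA ;
  dep_nu : L -> depB ;
  dep_beta : depH -> depB ;
  dep_mu_epi : epi dep_mu ;
  dep_alpha_epi : epi dep_alpha ;
  dep_nu_epi : epi dep_nu ;
  dep_beta_epi : epi dep_beta ;
  dep_nu_mu : forall x : Gam, dep_nu (set_val x) = set_val (dep_mu x) ;
  dep_beta_alpha : forall x : depG, dep_beta (set_val x) = set_val (dep_alpha x)
}.

Arguments dep_mu {F L Gam} p _.
Arguments dep_alpha {F L Gam} p _.
Arguments dep_nu {F L Gam} p _.
Arguments dep_beta {F L Gam} p _.

Section DEP.
Variables (F : finGroupType -> Prop) (L : profiniteGroupType).
Variable (Gam : closedSubgroup L).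

Definition finite_DEP (E : proDEP F Gam) : Prop :=
  [/\ member F (depG E), member F (depH E), member F (depA E) & member F (depB E)].

Definition weak_solution_lower (E : proDEP F Gam) (eta : Gam -> depG E) : Prop :=
  hom eta /\ dep_alpha E \o eta =1 dep_mu E.

Definition weak_solution (E : proDEP F Gam)
    (eta : Gam -> depG E) (theta : L -> depH E) : Prop :=
  [/\ weak_solution_lower eta, hom theta, dep_beta E \o theta =1 dep_nu E
    & forall x : Gam, theta (set_val x) = set_val (eta x)].

Definition projective_pair : Prop :=
  [/\ pro F Gam, pro F L
    & forall E : proDEP F Gam, finite_DEP E ->
        exists (eta : Gam -> depG E) (theta : L -> depH E), weak_solution eta theta].
End DEP.

(* Main.v *)
From HB Require Import structures.
Require Import Defs.
From mathcomp Require Import all_boot all_fingroup all_classical topology.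
From mathcomp Require Import finmap.

(* Replace a homomorphism [Lambda -> H / M], with [M] normal in [H], by its
   preimage in [Lambda * H], a closed subgroup [R]. By Zorn's lemma there is a
   minimal [R] among those that lift [nu] and extend [eta] modulo [M]; it is the
   graph of the required [theta] as soon as [M = 1]. If [M] contained [h <> 1],
   choose an open normal subgroup [U] of [H] avoiding [h] and an open normal
   subgroup [N] of [Lambda] so small that [R] modulo [U] and [eta] modulo [U]
   factor through [Lambda / N]. In the double embedding problem with
   [B = Lambda / N], [H' = (image of R in Lambda / N * H / U)], [A] the image of
   [Gamma] in [B] and [G'] the graph of [eta] modulo [U], the map [G' -> A] is
   bijective because [N] meets [Gamma] inside the kernel of [eta] modulo [U].
   Hence a weak solution, which exists by projectivity, extends [eta] modulo
   [U], and it cuts out a smaller [R]. The group [H'] belongs to the formation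
   as an extension of [B] by a normal subgroup of [H / U]; normality of [M] is
   kept because subgroups of members of the formation need not be members. *)

Set Implicit Arguments.
Unset Strict Implicit.
Unset Printing Implicit Defensive.

Local Open Scope group_scope.
Local Open Scope classical_set_scope.

(** * Compactness and zero-dimensionality *)

(** Directedness makes the [f i] a base of a proper filter; a cluster point of it lies in every
    [f i], because these are closed. *)
Lemma compact_directed_bigcap (T : topologicalType) I (D : set I)
    (f : I -> set T) :
  compact [set: T] -> D !=set0 ->
  (forall i, D i -> closed (f i)) -> (forall i, D i -> f i !=set0) ->
  (forall i j, D i -> D j -> exists2 k, D k & f k `<=` f i `&` f j) ->
  \bigcap_(i in D) f i !=set0.
Proof.
move=> cT D0 fcl f0 fdir.
have FF : ProperFilter (filter_from D f).
  by apply: filter_from_proper => //; exact: filter_from_filter.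
have [p [_ clp]] := cT _ FF filterT.
exists p => i Di; apply: fcl => // B Bp.
by apply: clp => //; exists i.
Qed.

(** [C] is closed in a compact product, hence compact; its image under [fst] is compact in a
    Hausdorff space. *)
Lemma closed_fst_image (T U : topologicalType) (C : set (T * U)) :
  compact [set: T] -> compact [set: U] -> hausdorff_space T ->
  closed C -> closed [set x | exists y, C (x, y)].
Proof.
move=> cT cU hT clC.
have -> : [set x | exists y, C (x, y)] = fst @` C.
  apply/seteqP; split=> [x [y Cxy]|_ [[x y] Cxy <-]]; last by exists y.
  by exists (x, y).
apply: compact_closed => //; apply: continuous_compact.
  by apply: continuous_subspaceT => x; exact: cvg_fst.
apply: (@subclosed_compact _ _ setT) => //.
by rewrite -setXTT; exact: compact_setX.
Qed.

(** The tube lemma along the compact factor [T]. *)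
Lemma nbhs_tube (T U : topologicalType) (V : set (T * U)) (y : U) :
  compact [set: T] -> open V -> (forall x, V (x, y)) ->
  \forall y' \near y, forall x, V (x, y').
Proof.
move=> cT oV Vy.
have : \forall y' \near y, [set: T] `<=` (fun x => V (x, y')).
  apply: (iffLR (compact_near_coveringP _) cT) => x _.
  have : nbhs (x, y) V by exact: open_nbhs_nbhs.
  by apply: filterS => -[].
by apply: filterS => y' Vy' x; exact: Vy'.
Qed.

(* The quasi-component [Q] of [x] is connected: if it were the union of two
   disjoint closed sets, normality and compactness would provide a clopen
   neighbourhood of [x] missing the second one. *)
Lemma totally_disconnected_zero_dimensional (T : topologicalType) :
  compact [set: T] -> hausdorff_space T -> totally_disconnected [set: T] ->
  zero_dimensional T.
Proof.
move=> cT hT dT x y xy; apply: contrapT => nsep.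
pose D := [set K : set T | clopen K /\ K x].
pose Q := \bigcap_(K in D) K.
have Qcl : closed Q by apply: closed_bigI => K [[]].
have Qx : Q x by move=> K [].
have Qy : Q y.
  by move=> K [cK Kx]; apply: contrapT => nKy; apply: nsep; exists K.
have split_empty (B1 B2 : set T) : closed B1 -> closed B2 ->
    B1 `&` B2 = set0 -> Q `<=` B1 `|` B2 -> B1 x -> Q `&` B2 = set0.
  move=> cB1 cB2 B12 QB B1x.
  have [U [oU B1U UB2]] : exists U, [/\ open U, B1 `<=` U &
      closure U `<=` ~` B2].
    have [] := @compact_normal T hT cT B1 cB1 (~` B2).
      apply/set_nbhsP; exists (~` B2); split=> //; first exact: closed_openC.
      exact/disjoints_subset.
    move=> V /set_nbhsP[U [oU B1U UV]] VB2; exists U; split=> //.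
    by apply: subset_trans VB2; exact: closureS.
  (* Otherwise compactness yields a point of [Q] in [closure U] but not in [U]; such a point is
     neither in [B1] nor in [B2]. With this [K], the set [K] meets [U] and [closure U] alike, so the
     intersection is clopen. *)
  have [K [Kc Kx] KU] : exists2 K, D K & K `&` (closure U `\` U) = set0.
    apply: contrapT => noK.
    have [||||p Qp] := @compact_directed_bigcap T _ D
        (fun K => K `&` (closure U `\` U)) cT.
    - by exists setT; split=> //; exact: clopenT.
    - move=> K [[_ Kcl] _]; apply: closedI => //; apply: closedI.
        exact: closed_closure.
      exact: open_closedC.
    - move=> K DK; apply/set0P/eqP => K0; apply: noK; exists K => //.
    - move=> K1 K2 [K1c K1x] [K2c K2x]; exists (K1 `&` K2).
        by split; [exact: clopenI|].
      by move=> z [[? ?] ?].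
    have [_ [Up nUp]] : (setT `&` (closure U `\` U)) p.
      by apply: Qp; split=> //; exact: clopenT.
    have /QB[/B1U//|/(UB2 _ Up)//] : Q p by move=> K /Qp[].
  have KUE : K `&` U = K `&` closure U.
    apply/seteqP; split=> [z [Kz Uz]|z [Kz Uz]]; split=> //.
      exact: subset_closure.
    by apply: contrapT => nUz; have : set0 z by rewrite -KU.
  have DKU : D (K `&` U).
    split; last by split=> //; exact: B1U.
    case: Kc => oK cK; split; first exact: openI.
    by rewrite KUE; apply: closedI => //; exact: closed_closure.
  rewrite -subset0 => z [Qz B2z]; have [_ Uz] := Qz _ DKU.
  by apply: (UB2 z) => //; exact: subset_closure.
have Qcon : connected Q.
  move=> B [b Bb] [C oC BC] [E cE BE].
  have Bcl : closed B by rewrite BE; exact: closedI.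
  have B'cl : closed (Q `\` B).
    rewrite (_ : _ `\` _ = Q `&` ~` C).
      by apply: closedI => //; exact: open_closedC.
    by rewrite BC setDE setCI setIUr setICr set0U.
  have BQ : B `<=` Q by rewrite BC; exact: subIsetl.
  have QBB : Q `<=` B `|` (Q `\` B).
    by move=> z Qz; have [Bz|nBz] := pselect (B z); [left|right].
  (* Whichever of [B] and its complement in [Q] contains [x], [split_empty] shows that the other one
     is empty. *)
  have [Bx|nBx] := pselect (B x).
    have Q0 : Q `&` (Q `\` B) = set0.
      by apply: (split_empty B) => //; rewrite -subset0 => z [? []].
    apply/seteqP; split=> // z Qz.
    apply: contrapT => nBz; suff : set0 z by [].
    by rewrite -Q0.
  have Q0 : Q `&` B = set0.
    apply: (split_empty (Q `\` B)) => //; last by rewrite setUC.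
    by rewrite -subset0 => z [[]].
  suff : set0 b by [].
  by rewrite -Q0; split=> //; exact: BQ.
have : connected_component [set: T] x y by exists Q.
by rewrite dT // => yx; move: xy; rewrite yx eqxx.
Qed.

(** * Open normal subgroups of a profinite group *)

Section ProfiniteTopology.
Variable P : profiniteGroupType.

Lemma profinite_clopen_nbhs1 (W : set P) :
  nbhs (1 : P) W -> exists C : set P, [/\ clopen C, C 1 & C `<=` W].
Proof.
have zP : zero_dimensional P.
  apply: totally_disconnected_zero_dimensional.
  - exact: profinite_compact.
  - exact: profinite_hausdorff.
  - exact: profinite_disconnected.
move=> /(zero_dimensional_cvg (@profinite_hausdorff P) zP
  (@profinite_compact P))[C [C1 cC] CW].
by exists C.
Qed.

Record open_normal (N : set P) : Prop := OpenNormal {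
  open_normal_nbhs : nbhs (1 : P) N ;
  open_normal1 : N 1 ;
  open_normalM : forall x y, N x -> N y -> N (x * y) ;
  open_normalV : forall x, N x -> N x^-1 ;
  open_normalJ : forall x y, N x -> N (y^-1 * x * y)
}.

(* For a clopen neighbourhood [C] of [1], the set of [x] such that
   [a x b \in C <-> a b \in C] for all [a] and [b] is a normal subgroup in [C];
   it is open by compactness of [P * P]. *)
Lemma open_normal_basis (W : set P) :
  nbhs (1 : P) W -> exists2 N, open_normal N & N `<=` W.
Proof.
move=> /profinite_clopen_nbhs1[C [[oC cC] C1 CW]].
pose N := [set x : P | forall a b, C (a * x * b) <-> C (a * b)].
have N1 : N 1 by move=> a b; rewrite mulg1.
exists N; last first.
  by move=> x /(_ 1 1) [_]; rewrite !mul1g !mulg1 => /(_ C1) /CW.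
split=> //.
- have cPP : compact [set: P * P].
    by rewrite -setXTT; apply: compact_setX; exact: profinite_compact.
  pose f (p : P * P * P) : P := p.1.1 * p.2 * p.1.2.
  pose g (p : P * P * P) : P := p.1.1 * p.1.2.
  have mulc (u v : P * P * P -> P) : continuous u -> continuous v ->
      continuous (fun p => u p * v p : P).
    move=> cu cv p.
    apply: (@continuous2_cvg _ P P P _ _ u v (fun x y => x * y)).
    - exact: (@mulg_continuous P (u p, v p)).
    - exact: cu.
    - exact: cv.
  have c11 : continuous (fun p : P * P * P => p.1.1 : P).
    by move=> p; apply: cvg_comp; [exact: cvg_fst|exact: cvg_fst].
  have c12 : continuous (fun p : P * P * P => p.1.2 : P).
    by move=> p; apply: cvg_comp; [exact: cvg_fst|exact: cvg_snd].
  have c2 : continuous (fun p : P * P * P => p.2 : P).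
    by move=> p; exact: cvg_snd.
  have cf : continuous f by apply: (mulc) => //; exact: mulc.
  have cg : continuous g by exact: mulc.
  pose V := (f @^-1` C `&` g @^-1` C) `|` (f @^-1` (~` C) `&` g @^-1` (~` C)).
  have oV : open V.
    by apply: openU; apply: openI; apply: open_comp => //; exact: closed_openC.
  have : \forall x \near (1 : P), forall ab, V (ab, x).
    apply: nbhs_tube => // -[a b]; rewrite /V /f /g /= mulg1.
    by have [Cab|nCab] := pselect (C (a * b)); [left|right].
  apply: filterS => x Vx a b.
  by have [[Cf Cg]|[Cf Cg]] := Vx (a, b).
- move=> x y Nx Ny a b; rewrite mulgA.
  by apply: iff_trans (Ny _ _) _; exact: Nx.
- move=> x Nx a b; have := Nx (a * x^-1) b; rewrite -!mulgA mulKg => H.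
  exact: iff_sym.
- move=> x y Nx a b; have := Nx (a * y^-1) (y * b).
  by rewrite !mulgA mulgKV.
Qed.
End ProfiniteTopology.

(** * Finite quotients *)

Lemma morph_mul1 (G K : groupType) (f : G -> K) :
  {morph f : x y / x * y} -> f 1 = 1.
Proof. by move=> fM; apply: (@mulgI _ (f 1)); rewrite -fM !mulg1. Qed.

Lemma morph_mulV (G K : groupType) (f : G -> K) :
  {morph f : x y / x * y} -> {morph f : x / x^-1}.
Proof.
by move=> fM x; apply: (@mulgI _ (f x)); rewrite -fM !mulgV morph_mul1.
Qed.

Lemma inj_surj_bijective (T U : Type) (f : T -> U) :
  injective f -> surjective f -> bijective f.
Proof.
move=> fI fS; pose g y := sval (cid (fS y)).
have gK : cancel g f by move=> y; rewrite /g; case: cid.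
by exists g => // x; apply: fI; rewrite gK.
Qed.

(** The fibers of [c] are the classes of a congruence, so products of representatives make the image
    of [c] a group. The codomain is a bare finite set: this allows labels of cosets as well as
    embeddings in a finite group. *)
Lemma finite_quotient_group (G : groupType) (T : finType) (c : G -> T) :
  (forall x y z w, c x = c y -> c z = c w -> c (x * z) = c (y * w)) ->
  exists (K : finGroupType) (q : G -> K),
    [/\ {morph q : x y / x * y}, surjective q
      & forall x y, q x = q y <-> c x = c y].
Proof.
move=> cM; pose T' := {t : T | `[< exists x, c x = t >]}.
have q0 x : `[< exists y, c y = c x >] by apply/asboolP; exists x.
pose q x : T' := exist _ (c x) (q0 x).
have qS : surjective q.
  by move=> [t t_im]; have /asboolP[x xt] := t_im; exists x; exact: val_inj.
have qE x y : q x = q y <-> c x = c y.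
  by split=> [/(congr1 val)|xy]; [|exact: val_inj].
pose s t := sval (cid (qS t)).
have sK t : q (s t) = t by rewrite /s; case: cid.
have qM x y z w : q x = q y -> q z = q w -> q (x * z) = q (y * w).
  by move=> /qE xy /qE zw; apply/qE; exact: cM.
pose mul t u := q (s t * s u).
have mulA : associative mul.
  move=> t u v; rewrite /mul (qM _ (s t) _ (s u * s v)) ?sK //.
  by rewrite mulgA; apply: qM; rewrite ?sK.
have mul1 : left_id (q 1) mul.
  by move=> t; rewrite /mul (qM _ 1 _ (s t)) ?sK // mul1g sK.
have mulV : left_inverse (q 1) (fun t => q (s t)^-1) mul.
  by move=> t; rewrite /mul (qM _ (s t)^-1 _ (s t)) ?sK // mulVg.
pose K : finGroupType := HB.pack T' (Finite_isGroup.Build T' mulA mul1 mulV).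
exists K, q; split=> // x y.
by apply: (qM); rewrite sK.
Qed.

Lemma continuous_discrete (T : topologicalType) (K : choiceType)
    (f : T -> discrete_topology K) :
  (forall x, \forall y \near x, f y = f x) -> continuous f.
Proof. by move=> fc x; apply/discrete_cvg => //; exact: fc. Qed.

Lemma discrete_continuous_near (T : topologicalType) (K : choiceType)
    (f : T -> discrete_topology K) :
  continuous f -> forall x, \forall y \near x, f y = f x.
Proof. by move=> fc x; have /discrete_cvg := fc x; exact. Qed.

Lemma translate_near (P : topologicalGroupType) (N : set P) (x : P) :
  nbhs (1 : P) N -> \forall y \near x, N (x^-1 * y).
Proof.
move=> N1.
have : x^-1 * y @[y --> x] --> (x^-1 * x : P).
  apply: (@continuous2_cvg _ P P P _ _ (fun=> x^-1) id (fun a b => a * b)).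
  - exact: (@mulg_continuous P (x^-1, x)).
  - exact: cvg_cst.
  - exact: cvg_id.
by rewrite mulVg; apply.
Qed.

(** The cosets of [N] form an open cover; [D] consists of the representatives in a finite
    subcover. *)
Lemma open_normal_finite_index (P : profiniteGroupType) (N : set P) :
  open_normal N ->
  exists D : {fset P}, forall x, exists2 d, d \in D & N (d^-1 * x).
Proof.
move=> [Nn N1 NM NV NJ].
pose T : ptopologicalType := HB.pack P (isPointed.Build P 1).
have : @cover_compact T [set: T].
  by rewrite -compact_cover; exact: (@profinite_compact P).
case/(_ P setT (fun d => [set x | N (d^-1 * x)])).
- move=> d _; rewrite openE => x Nx; rewrite /interior.
  apply: filterS (translate_near x Nn) => y Ny /=.
  by rewrite -(mulgK x d^-1) -mulgA; exact: NM.
- by move=> x _; exists x => //=; rewrite mulVg.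
move=> D _ cD; exists D => x.
by have [//|d dD Ndx] := cD x; exists d.
Qed.

Lemma open_normal_quotient (P : profiniteGroupType) (N : set P) :
  open_normal N ->
  exists (K : finGroupType) (q : P -> K),
    [/\ {morph q : x y / x * y}, surjective q, forall x, q x = 1 <-> N x
      & continuous (q : P -> discrete_topology K)].
Proof.
move=> oN; have [D cD] := open_normal_finite_index oN.
case: oN => Nn N1 NM NV NJ.
(* [c x] records the representatives in [D] that lie in the coset of [x]. It is never empty, so it
   determines the coset. *)
pose c x : {set D} := [set d : D | `[< N ((val d)^-1 * x) >]]%SET.
have cE x y : c x = c y <-> N (x^-1 * y).
  split=> [cxy|Nxy].
    have [d dD Ndx] := cD x.
    have : [` dD]%fset \in c x by rewrite inE; apply/asboolP.
    rewrite cxy inE => /asboolP /= Ndy.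
    by have := NM _ _ (NV _ Ndx) Ndy; rewrite invMg invgK -mulgA mulKVg.
  apply/setP => d; rewrite !inE; apply: asbool_equiv_eq; split=> Nd.
    by have := NM _ _ Nd Nxy; rewrite -mulgA mulKVg.
  by have := NM _ _ Nd (NV _ Nxy); rewrite invMg invgK -mulgA mulKVg.
have [x y z w /cE Nxy /cE Nzw|K [q [qM qS qE]]] :=
  @finite_quotient_group P _ c.
  apply/cE; rewrite invMg.
  have := NM _ _ (NJ _ z Nxy) Nzw.
  by rewrite -!mulgA mulKVg.
have q1 x : q x = 1 <-> N x.
  rewrite -(morph_mul1 qM); split=> [/esym/qE/cE|Nx].
    by rewrite invg1 mul1g.
  by apply/esym/qE/cE; rewrite invg1 mul1g.
exists K, q; split=> //.
apply: continuous_discrete => x.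
by apply: filterS (translate_near x Nn) => y /cE /qE.
Qed.

(** * Finite discrete groups and members of a formation *)

Section DiscreteGroup.
Variable K : finGroupType.
Local Notation T := (discrete_topology K).

HB.instance Definition _ := monoid.Group.copy T K.

Lemma discrete_mul_continuous : continuous (fun x : T * T => (x.1 * x.2 : T)).
Proof.
apply: continuous_discrete => -[x y].
exists ([set x], [set y]); first by split; exact: discrete_set1.
by move=> [a b] [/= -> ->].
Qed.

Lemma discrete_inv_continuous : continuous (fun x : T => (x^-1 : T)).
Proof.
apply: continuous_discrete => x.
by apply: (@filterS T (nbhs x) _ [set x] _ _ (discrete_set1 x)) => y ->.
Qed.

HB.instance Definition _ := isTopologicalGroup.Build T
  discrete_mul_continuous discrete_inv_continuous.

Lemma discrete_compact : compact [set: T].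
Proof.
apply: finite_compact; apply: (@sub_finite_set K _ [set` {: K}]) => //.
Qed.

HB.instance Definition _ := isProfinite.Build T discrete_compact
  discrete_hausdorff
  (zero_dimension_totally_disconnected discrete_zero_dimension).
End DiscreteGroup.

Section Melnikov.
Variables (F : finGroupType -> Prop) (FM : melnikov_formation F).

Lemma melnikov_kernel (B C : finGroupType) (p : B -> C) (K : {group B}) :
  {morph p : x y / x * y} -> surjective p ->
  (forall b, (b \in K) = (p b == 1)) ->
  F [subg K]%type /\ F C <-> F B.
Proof.
move=> pM pS KE; apply: (melnikov_exact FM (i := @sgval _ K) (p := p)).
split=> //; first exact: val_inj.
move=> b; split=> [pb1|[a <-]]; last by apply/eqP; rewrite -KE subgP.
have bK : b \in K by rewrite KE pb1.
by exists (subg K b); rewrite subgK.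
Qed.

Lemma melnikov_quotient (B C : finGroupType) (p : B -> C) :
  {morph p : x y / x * y} -> surjective p -> F B -> F C.
Proof.
move=> pM pS FB.
have gK : group_set [set b | p b == 1]%SET.
  apply/group_setP; split=> [|x y]; first by rewrite inE morph_mul1.
  by rewrite !inE pM => /eqP -> /eqP ->; rewrite mulg1.
have [|_ /(_ FB)[]//] := @melnikov_kernel B C p (Group gK) pM pS.
by move=> b; rewrite inE.
Qed.

Lemma melnikov_normal (B : finGroupType) (M : {group B}) :
  (forall x y, x \in M -> x ^ y \in M) -> F B -> F [subg M]%type.
Proof.
move=> MJ FB.
(* A conjugate of [M] contained in [M] equals [M], having the same cardinality. *)
have nM x : x \in 'N(M) by apply/normP/eqP; rewrite eqEcard cardJg leqnn andbT;
  apply/fintype.subsetP => _ /imsetP[y My ->]; exact: MJ.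
have cM : {morph coset M : x y / x * y} by move=> x y; exact: morphM.
have cS : surjective (coset M).
  by move=> y; exists (repr y); exact: coset_reprK.
have [|_ /(_ FB)[]//] := @melnikov_kernel B _ (coset M) M cM cS.
by move=> b; apply/idP/eqP => [/coset_id//|/coset_idr]; exact.
Qed.

Lemma pro_epi (P Q : profiniteGroupType) (f : P -> Q) :
  epi f -> pro F P -> pro F Q.
Proof.
move=> [[fM fc] fS] FP K g gM gc gS; apply: (FP K (g \o f)).
- by move=> x y /=; rewrite fM gM.
- by move=> x; apply: (continuous_comp (fc x)); exact: gc.
- by move=> k; have [y <-] := gS k; have [x <-] := fS y; exists x.
Qed.

(** [K] may lie outside the formation, so the witness is the image of [f], rebuilt as a finite
    continuous quotient of [P]. *)
Lemma pro_member (P : profiniteGroupType) (K : finGroupType) (f : P -> K) :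
  {morph f : x y / x * y} -> injective f ->
  continuous (f : P -> discrete_topology K) -> pro F P -> member F P.
Proof.
move=> fM fI fc FP.
have [x y z w|K' [q [qM qS qE]]] := @finite_quotient_group P K f.
  by rewrite !fM => -> ->.
have qc : continuous (q : P -> discrete_topology K').
  apply: continuous_discrete => x.
  by apply: filterS (discrete_continuous_near fc x) => y /qE.
exists K'; split; first exact: (FP K' q).
exists q; split=> //; apply: inj_surj_bijective => // x y /qE; exact: fI.
Qed.

Lemma pro_discrete (K : finGroupType) : F K -> pro F (discrete_topology K).
Proof. by move=> FK K' f fM _ fS; apply: (melnikov_quotient fM fS). Qed.

Lemma member_discrete (K : finGroupType) :
  F K -> member F (discrete_topology K).
Proof. by move=> FK; exists K; split=> //; exists id; split=> //; exists id. Qed.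

Lemma member_subgroup (K : finGroupType)
    (S : closedSubgroup (discrete_topology K)) : pro F S -> member F S.
Proof.
apply: (@pro_member S K (fun x : S => set_val x : discrete_topology K)) => //.
exact: subgroup_val_continuous.
Qed.
End Melnikov.

Lemma discrete_source_continuous (K : finGroupType) (T : topologicalType)
  (f : discrete_topology K -> T) : continuous f.
Proof.
move=> x A fxA.
apply: (@filterS _ (nbhs x) _ [set x] _ _ (discrete_set1 x)) => y /= ->.
exact: nbhs_singleton.
Qed.

(** * Images of homomorphisms to finite groups *)

Section ImageSubgroup.
Variables (P : profiniteGroupType) (K : finGroupType).
Variable f : P -> discrete_topology K.
Hypothesis fM : {morph f : x y / x * y}.

Lemma range1 : range f 1.
Proof. by exists 1 => //; exact: morph_mul1. Qed.

Lemma rangeM x y : range f x -> range f y -> range f (x * y).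
Proof. by move=> [a _ <-] [b _ <-]; exists (a * b). Qed.

Lemma rangeV x : range f x -> range f x^-1.
Proof. by move=> [a _ <-]; exists a^-1 => //; exact: morph_mulV. Qed.

Definition image_subgroup : closedSubgroup (discrete_topology K) :=
  ClosedSubgroup (discrete_closed (range f)) range1 rangeM rangeV.

Definition corestriction (x : P) : image_subgroup :=
  SigSub (mem_set (imageT f x)).

Lemma corestriction_epi : continuous f -> epi corestriction.
Proof.
move=> fc; split; first split.
- by move=> x y; apply: val_inj => /=.
- exact: subgroup_continuous.
- move=> y; have [x _ xy] := set_valP y.
  by exists x; apply: val_inj.
Qed.
End ImageSubgroup.

Section ImageMap.
Variables (P : profiniteGroupType) (K1 K2 : finGroupType).
Variables (f1 : P -> discrete_topology K1) (f2 : P -> discrete_topology K2).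
Hypotheses (f1M : {morph f1 : x y / x * y}) (f2M : {morph f2 : x y / x * y}).
Variable h : discrete_topology K1 -> discrete_topology K2.
Hypotheses (hM : {morph h : x y / x * y}) (hf : forall x, h (f1 x) = f2 x).

Lemma image_map_subproof (u : image_subgroup f1M) : range f2 (h (set_val u)).
Proof. by have [x _ xu] := set_valP u; exists x; rewrite // -hf xu. Qed.

Definition image_map (u : image_subgroup f1M) : image_subgroup f2M :=
  SigSub (mem_set (image_map_subproof u)).

Lemma image_map_epi : epi image_map.
Proof.
split; first split.
- by move=> x y; apply: val_inj; rewrite /= hM.
- apply: subgroup_continuous => x.
  apply: (continuous_comp (@subgroup_val_continuous _ _ x)).
  exact: discrete_source_continuous.
- move=> y; have [x _ xy] := set_valP y.
  by exists (corestriction f1M x); apply: val_inj; rewrite /= hf.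
Qed.
End ImageMap.

(** * Projectivity applied to a finite target *)

(** The relation [T] encodes a homomorphism with open kernel from [L] to the quotient of [K] by the
    normal subgroup of all [a] with [T 1 a]. Projectivity lifts it to [K] with prescribed
    restriction [e] to [Gam]. *)
Lemma projective_pair_finite_lift (F : finGroupType -> Prop)
    (L : profiniteGroupType) (Gam : closedSubgroup L)
    (FM : melnikov_formation F) (proj : projective_pair F Gam)
    (K : finGroupType) (FK : F K) (T : L -> K -> Prop) (e : Gam -> K) :
  (forall x y a b, T x a -> T y b -> T (x * y) (a * b)) ->
  (forall x a, T x a -> T x^-1 a^-1) ->
  nbhs (1 : L) [set x | T x 1] ->
  (forall x, exists a, T x a) ->
  (forall a b, T 1 a -> T 1 (a ^ b)) ->
  {morph e : x y / x * y} -> continuous (e : Gam -> discrete_topology K) ->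
  (forall g, T (set_val g) (e g)) ->
  exists th : L -> K, [/\ {morph th : x y / x * y},
    continuous (th : L -> discrete_topology K),
    forall x, T x (th x) & forall g : Gam, th (set_val g) = e g].
Proof.
move=> TM TV Tn TS TJ eM ec eT; have [FGam FL solve] := proj.
have T11 : T 1 1 by exact: nbhs_singleton Tn.
(* The kernel of [e] is open only in [Gam]; [W] is a neighbourhood in [L] whose trace on [Gam] lies
   in that kernel. *)
have [W Wn We] : exists2 W : set L, nbhs (1 : L) W &
    forall g : Gam, W (set_val g) -> e g = 1.
  have := discrete_continuous_near ec 1; rewrite morph_mul1 //.
  move=> [_ [[W oW <-] W1 We]]; exists W; last exact: We.
  exact: open_nbhs_nbhs.
have [N oN NTW] := open_normal_basis (filterI Tn Wn).
have [B [q [qM qS q1 qc]]] := open_normal_quotient oN.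
(* Since [N] lies in the kernel of the homomorphism encoded by [T], the relation depends on [x] only
   through [q x]. *)
have qT x y a : q x = q y -> T x a -> T y a.
  move=> qxy Txa; have /q1/NTW[/= Ty _] : q (y * x^-1) = 1.
    by rewrite qM morph_mulV // qxy mulgV.
  by have := TM _ _ _ _ Ty Txa; rewrite mulgKV mul1g.
have FB : F B by exact: (FL B q).
have gH : group_set [set u : B * K | `[< exists x, q x = u.1 /\ T x u.2 >]]%SET.
  apply/group_setP; split=> [|u v].
    by rewrite inE; apply/asboolP; exists 1; split=> //; exact: morph_mul1.
  rewrite !inE => /asboolP[x [qx Tx]] /asboolP[y [qy Ty]].
  by apply/asboolP; exists (x * y); rewrite qM qx qy; split=> //; exact: TM.
pose Hg := Group gH.
have HgP u : u \in Hg -> exists x, q x = u.1 /\ T x u.2.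
  by rewrite inE => /asboolP.
have inHg x a : T x a -> (q x, a) \in Hg.
  by move=> Txa; rewrite inE; apply/asboolP; exists x.
have FH : F [subg Hg]%type.
  have gM : group_set [set a | `[< T 1 a >]]%SET.
    apply/group_setP; split=> [|a b]; first by rewrite inE; apply/asboolP.
    rewrite !inE => /asboolP Ta /asboolP Tb; apply/asboolP.
    by rewrite -(mulg1 1); exact: TM.
  have FMg : F [subg Group gM]%type.
    apply: melnikov_normal => // a b; rewrite !inE => /asboolP Ta.
    by apply/asboolP; exact: TJ.
  have i_in (a : [subg Group gM]) : (1, sgval a) \in Hg.
    rewrite -(morph_mul1 qM); apply: inHg.
    by have := subgP a; rewrite inE => /asboolP.
  pose i (a : [subg Group gM]) : [subg Hg] := Subg (i_in a).
  pose p (u : [subg Hg]) : B := (sgval u).1.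
  apply: (iffLR (melnikov_exact FM (i := i) (p := p) _)) => //; split.
  - by move=> a b; apply/val_inj/injective_projections; rewrite /= ?mulg1.
  - by [].
  - by move=> a b /(congr1 val) /= [] /val_inj.
  - move=> b; have [x <-] := qS b; have [a Ta] := TS x.
    by exists (Subg (inHg _ _ Ta)).
  - move=> u; split=> [pu1|[a <-]//].
    have [x [qx Tx]] := HgP _ (subgP u).
    (* Exactness in the middle: a pair over [1] comes from some [x] with [q x = q 1], so [qT] moves
       the relation from [x] to [1]. *)
    have T1u : T 1 (sgval u).2 by apply: qT Tx; rewrite qx morph_mul1.
    have uM : (sgval u).2 \in Group gM by rewrite inE; apply/asboolP.
    exists (Subg uM); apply: val_inj => /=.
    by rewrite [RHS]surjective_pairing; congr (_, _); rewrite -pu1.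
pose p (u : discrete_topology [subg Hg]) : discrete_topology B := (sgval u).1.
pose fA (g : Gam) : discrete_topology B := q (set_val g).
pose fG (g : Gam) : discrete_topology [subg Hg] := Subg (inHg _ _ (eT g)).
have fAM : {morph fA : x y / x * y} by move=> x y; exact: qM.
have fGM : {morph fG : x y / x * y}.
  by move=> x y; apply/val_inj/injective_projections; [exact: qM|exact: eM].
have fAc : continuous fA.
  move=> x; apply: (continuous_comp (@subgroup_val_continuous _ _ x)).
  exact: qc.
have fGc : continuous fG.
  apply: continuous_discrete => x.
  apply: filterS2 (discrete_continuous_near fAc x)
    (discrete_continuous_near ec x).
  by move=> y qy ey; apply: val_inj; congr (_, _).
have pM : {morph p : x y / x * y} by [].
have pS : surjective p.
  move=> b; have [x <-] := qS b; have [a Ta] := TS x.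
  by exists (Subg (inHg _ _ Ta)).
have pf g : p (fG g) = fA g by [].
have muE := corestriction_epi fAM fAc.
have alE := image_map_epi fGM fAM pM pf.
(* The lower groups are subgroups of members of the formation, which is not enough; they belong to
   it as quotients of [Gam]. *)
have FA := pro_epi muE FGam.
have FG := pro_epi (corestriction_epi fGM fGc) FGam.
pose E : proDEP F Gam := @ProDEP F L Gam (discrete_topology B)
  (image_subgroup fAM) (discrete_topology [subg Hg]) (image_subgroup fGM)
  (pro_discrete FM FB) FA (pro_discrete FM FH) FG
  (corestriction fAM) (image_map fAM pf) q p
  muE alE (conj (conj qM qc) qS)
  (conj (conj pM (@discrete_source_continuous _ _ p)) pS)
  (fun=> erefl) (fun=> erefl).
have Efin : finite_DEP E.
  by split; [exact: member_subgroup|exact: member_discrete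
            |exact: member_subgroup|exact: member_discrete].
have [eta [th [_ [thM thc] thq thG]]] := solve E Efin.
exists (fun x => (sgval (th x)).2); split.
- by move=> x y; rewrite thM.
- apply: continuous_discrete => x.
  by apply: filterS (discrete_continuous_near thc x) => y ->.
- move=> x; have [y [qy Ty]] := HgP _ (subgP (th x)).
  by apply: qT Ty; exact: etrans qy (thq x).
(* The solver returns some [eta g], which is [fG g'] for an unknown [g']. Both [g] and [g'] have the
   same image in [B], so [g'^-1 * g] lies in [N], hence in [W], and [e g = e g']. *)
- move=> g; have thqg : p (th (set_val g)) = q (set_val g) := thq (set_val g).
  have [g' _ g'E] := set_valP (eta g).
  have thg : th (set_val g) = fG g' by rewrite thG; exact: esym.
  have /q1/NTW[_ /We] : q (set_val (g'^-1 * g)) = 1.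
    by rewrite qM morph_mulV // -thqg thg mulVg.
  rewrite eM morph_mulV // thg => eg.
  by apply: (@mulgI _ (e g')^-1); rewrite eg mulVg.
Qed.

(** * Zorn's lemma and partial lifts *)

(** Zorn's lemma for reverse inclusion; intersections bound the nonempty chains, and a given member
    of [P] bounds the empty one. *)
Lemma Zorn_minimal (T : Type) (P : set (set T)) :
  P !=set0 ->
  (forall C, C !=set0 -> C `<=` P -> total_on C subset ->
    P (\bigcap_(X in C) X)) ->
  exists2 A, P A & forall B, P B -> B `<=` A -> A `<=` B.
Proof.
move=> [A0 PA0] PI; pose S := {A : set T | P A}.
pose le (A B : S) := `[< sval B `<=` sval A >].
have [||D Dtot|[A PA] Amin] := @ZL_preorder S (exist _ A0 PA0) le.
- by move=> A; apply/asboolP.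
- move=> A B C /asboolP AB /asboolP BC; apply/asboolP.
  exact: subset_trans AB.
- have [[A DA]|D0] := pselect (D !=set0); last first.
    by exists (exist _ A0 PA0) => A DA; case: D0; exists A.
  have PD : P (\bigcap_(X in sval @` D) X).
    apply: PI; first by exists (sval A), A.
      by move=> _ [[X PX] _ <-].
    move=> _ _ [X DX <-] [Y DY <-].
    by have [/asboolP|/asboolP] := Dtot _ _ DX DY; [right|left].
  exists (exist _ _ PD) => B DB; apply/asboolP => x /=; apply.
  by exists B.
exists A => // B PB BA.
by have /asboolP := Amin (exist _ B PB) (introT (asboolP _) BA).
Qed.

Lemma profinite_closed1 (P : profiniteGroupType) (x : P) : closed [set x].
Proof.
apply: accessible_closed_set1; apply: hausdorff_accessible.
exact: profinite_hausdorff.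
Qed.

Section Lifting.
Variables (L H B : profiniteGroupType) (Gam : closedSubgroup L).
Variables (nu : L -> B) (beta : H -> B) (e : Gam -> H).

(* A closed subgroup [R] of the fiber product of [nu] and [beta] that contains
   the graph of [e], maps onto [L], and whose fiber [M] over [1] is normal in
   [H], is the same as a homomorphism [L -> H / M] lifting [nu] and extending
   [e] modulo [M]. *)
Record partial_lift (R : set (L * H)) : Prop := PartialLift {
  lift_closed : closed R ;
  lift_fiber : forall x h, R (x, h) -> beta h = nu x ;
  liftM : forall x y h k, R (x, h) -> R (y, k) -> R (x * y, h * k) ;
  liftV : forall x h, R (x, h) -> R (x^-1, h^-1) ;
  lift_onto : forall x, exists h, R (x, h) ;
  liftJ : forall h k, R (1, h) -> R (1, k^-1 * h * k) ;
  lift_graph : forall g, R (set_val g, e g)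
}.

Lemma fiber_product_lift :
  hom nu -> epi beta -> (forall g, beta (e g) = nu (set_val g)) ->
  partial_lift [set p | beta p.2 = nu p.1].
Proof.
move=> [nuM nuc] [[bM bc] bS] be; split=> //=.
(* The fiber product is closed as the preimage of the closed point [1] under a continuous map. *)
- pose f (p : L * H) : B := (nu p.1)^-1 * beta p.2.
  have -> : [set p | beta p.2 = nu p.1] = f @^-1` [set 1].
    apply/seteqP; split=> p; rewrite /f /=; first by move=> ->; exact: mulVg.
    by move=> pf; apply: (@mulgI _ (nu p.1)^-1); rewrite mulVg.
  apply: closed_comp; last exact: profinite_closed1.
  move=> p _; apply: (@continuous2_cvg _ B B B _ _ _ _ (fun a b : B => a * b)).
  + exact: (@mulg_continuous B ((nu p.1)^-1, beta p.2)).
  + apply: (@continuous_comp _ _ _ (nu \o fst) (fun a : B => a^-1)).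
      by apply: continuous_comp; [exact: cvg_fst|exact: nuc].
    exact: invg_continuous.
  + by apply: continuous_comp; [exact: cvg_snd|exact: bc].
- by move=> x y h k hx ky; rewrite bM nuM hx ky.
- by move=> x h hx; rewrite (morph_mulV bM) hx (morph_mulV nuM).
- move=> h k h1; rewrite !bM h1 (morph_mul1 nuM) mulg1.
  by rewrite (morph_mulV bM) mulVg.
Qed.

(** Only surjectivity onto [L] needs an argument: the fibers over a fixed [x] form a chain of
    nonempty closed sets in the compact group [H]. *)
Lemma bigcap_partial_lift (C : set (set (L * H))) :
  C !=set0 -> C `<=` partial_lift -> total_on C subset ->
  partial_lift (\bigcap_(R in C) R).
Proof.
move=> [R0 CR0] CP Ctot; split.
- by apply: closed_bigI => R /CP[].
- by move=> x h /(_ _ CR0); exact: lift_fiber (CP _ CR0) _ _.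
- by move=> x y h k Rx Ry R CR; apply: (liftM (CP _ CR)); [exact: Rx|exact: Ry].
- by move=> x h Rx R CR; apply: (liftV (CP _ CR)); exact: Rx.
- move=> x; pose f R := [set h : H | (R : set (L * H)) (x, h)].
  have [|||h Ch] := @compact_directed_bigcap H _ C f (@profinite_compact H)
      (ex_intro _ _ CR0).
  + move=> R CR; rewrite (_ : f R = (fun h => (x, h)) @^-1` R) //.
    apply: closed_comp; last exact: lift_closed (CP _ CR).
    by move=> h _; apply: cvg_pair; [exact: cvg_cst|exact: cvg_id].
  + by move=> R CR; exact: lift_onto (CP _ CR) x.
  + move=> R S CR CS; have [RS|SR] := Ctot _ _ CR CS.
      by exists R => // h Rh; split=> //; exact: RS.
    by exists S => // h Sh; split=> //; exact: SR.
  by exists h => R CR; exact: Ch.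
- by move=> h k Rh R CR; apply: (liftJ (CP _ CR)); exact: Rh.
- by move=> g R CR; exact: lift_graph (CP _ CR) g.
Qed.

Lemma partial_lift_refine (F : finGroupType -> Prop) (R : set (L * H)) (h : H) :
  melnikov_formation F -> projective_pair F Gam -> pro F H -> hom e ->
  partial_lift R -> h <> 1 ->
  exists R', [/\ partial_lift R', R' `<=` R & ~ R' (1, h)].
Proof.
move=> FM proj FH [eM ec] Rl h1.
have [U oU Uh] : exists2 U, open_normal U & U `<=` ~` [set h].
  apply: open_normal_basis; apply: open_nbhs_nbhs; split; last exact: nesym.
  by apply: closed_openC; exact: profinite_closed1.
have [K [q [qM qS q1 qc]]] := open_normal_quotient oU.
(* [T] is [R] modulo [U]; its fiber over [1] is the image of [M] in [K]. *)
pose T x a := exists2 k, R (x, k) & q k = a.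
have [||||||||th [thM thc thT thG]] :=
  @projective_pair_finite_lift F L Gam FM proj K (FH K q qM qc qS) T (q \o e).
- move=> x y _ _ [k Rk <-] [l Rl' <-]; exists (k * l) => //.
  exact: (liftM Rl).
- move=> x _ [k Rk <-]; exists k^-1; first exact: (liftV Rl).
  exact: morph_mulV.
(* Openness of the kernel: the [x] having some lift [k] with [q k] outside the fiber of [T] over [1]
   form a closed set that misses [1]. For any other [x], dividing a lift [k] by some [l] in [M] with
   [q l = q k] gives [T x 1]. *)
- pose C := R `&` (q \o snd) @^-1` (~` [set a | T 1 a]).
  have Ccl : closed C.
    apply: closedI; first exact: lift_closed Rl.
    apply: (@closed_comp _ (discrete_topology K)); last exact: discrete_closed.
    by move=> p _; apply: continuous_comp; [exact: cvg_snd|exact: qc].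
  have fcl := closed_fst_image (@profinite_compact L) (@profinite_compact H)
    (@profinite_hausdorff L) Ccl.
  have : nbhs (1 : L) (~` [set x | exists k, C (x, k)]).
    apply: open_nbhs_nbhs; split; first exact: closed_openC.
    by move=> [k [Rk]]; apply; exists k.
  apply: filterS => x nCx; have [k Rk] := lift_onto Rl x.
  have [l Rl' lk] : T 1 (q k).
    by apply: contrapT => nT; apply: nCx; exists k.
  exists (k * l^-1); last by rewrite qM morph_mulV // lk mulgV.
  by rewrite -(mulg1 x) -invg1; apply: (liftM Rl) => //; exact: (liftV Rl).
- by move=> x; have [k Rk] := lift_onto Rl x; exists (q k), k.
- move=> _ b [k Rk <-]; have [l <-] := qS b.
  exists (l^-1 * k * l); first exact: (liftJ Rl).
  by rewrite !qM morph_mulV // conjgE mulgA.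
- by move=> x y /=; rewrite eM qM.
- by move=> x; apply: (continuous_comp (ec x)); exact: qc.
- by move=> g; exists (e g) => //; exact: lift_graph Rl g.
(* The smaller lift keeps the pairs that agree with [th] modulo [U]. It omits [(1, h)] because
   [th 1 = 1] while [h] is not in [U]. *)
exists (R `&` [set p | q p.2 = th p.1]); split; last 2 first.
- by move=> p [].
- move=> [_ /=]; rewrite morph_mul1 // => /q1 /Uh; exact.
split.
- apply: closedI; first exact: lift_closed Rl.
  pose f (p : L * H) : discrete_topology (K * K)%type := (q p.2, th p.1).
  rewrite (_ : mkset _ = f @^-1` [set u | u.1 = u.2]) //.
  apply: closed_comp; last exact: discrete_closed.
  move=> p _; move: p; apply: continuous_discrete => -[x k].
  exists ([set y | th y = th x], [set l | q l = q k]).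
    by split; exact: discrete_continuous_near.
  by move=> [y l] [/= yx lk]; rewrite /f /= yx lk.
- by move=> x k [/(lift_fiber Rl)].
- move=> x y k l [Rx /= qx] [Ry /= qy].
  by split=> /=; [exact: (liftM Rl)|rewrite qM thM qx qy].
- move=> x k [Rx /= qx].
  by split=> /=; [exact: (liftV Rl)|rewrite !morph_mulV // qx].
- by move=> x; have [k Rk qk] := thT x; exists k.
- move=> k l [Rk /=]; rewrite morph_mul1 // => qk.
  split=> /=; first exact: (liftJ Rl).
  by rewrite !qM qk mulg1 morph_mulV // mulVg.
- by move=> g; split=> /=; [exact: lift_graph Rl g|rewrite thG].
Qed.

(** Two values over the same [x] differ by an element of the fiber over [1], so [R] is a graph.
    Continuity is the closed graph theorem: the preimage of a closed [C] is the projection of a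
    closed part of [R] along the compact factor [H]. *)
Lemma partial_lift_graph (R : set (L * H)) :
  partial_lift R -> (forall h, R (1, h) -> h = 1) ->
  exists th : L -> H, hom th /\ forall x, R (x, th x).
Proof.
move=> Rl R1; pose th x := sval (cid (lift_onto Rl x)).
have Rth x : R (x, th x) by rewrite /th; case: cid.
have thE x h : R (x, h) -> h = th x.
  move=> Rh; apply: (@mulgI _ (th x)^-1); rewrite mulVg; apply: R1.
  by rewrite -(mulVg x); apply: (liftM Rl) => //; exact: (liftV Rl).
exists th; split=> //; split.
  by move=> x y; apply/esym/thE; exact: (liftM Rl).
apply/continuous_closedP => C Ccl.
have -> : th @^-1` C = [set x | exists h, (R `&` snd @^-1` C) (x, h)].
  apply/seteqP; split=> [x Cx|x [h [/thE /= ->]]//].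
  by exists (th x); split.
apply: closed_fst_image.
- exact: profinite_compact.
- exact: profinite_compact.
- exact: profinite_hausdorff.
apply: closedI; first exact: lift_closed Rl.
by apply: closed_comp => // p _; exact: cvg_snd.
Qed.
End Lifting.

Theorem proposition2p10 (F : finGroupType -> Prop) (L : profiniteGroupType)
    (Gam : closedSubgroup L) (FM : melnikov_formation F)
    (proj : projective_pair F Gam) (E : proDEP F Gam)
    (eta : Gam -> depG E) (eta_sol : weak_solution_lower eta) :
  exists theta : L -> depH E, weak_solution eta theta.
Proof.
have [[etaM etac] eta_al] := eta_sol.
pose e (g : Gam) : depH E := set_val (eta g).
have e_hom : hom e.
  split=> [x y|x]; first by rewrite /e etaM.
  by apply: (continuous_comp (etac x)); exact: subgroup_val_continuous.
have e_fiber g : dep_beta E (e g) = dep_nu E (set_val g).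
  by rewrite dep_beta_alpha dep_nu_mu -eta_al.
have Rl := fiber_product_lift (dep_nu_epi E).1 (dep_beta_epi E) e_fiber.
have [||R Rlift Rmin] :=
    @Zorn_minimal _ (partial_lift (dep_nu E) (dep_beta E) e).
- by eexists; exact: Rl.
- exact: bigcap_partial_lift.
(* A nontrivial element over [1] could be removed by a refinement, against minimality. *)
have R1 h : R (1, h) -> h = 1.
  move=> Rh; apply: contrapT => h1.
  have [R' [R'l R'R nR'h]] :=
    partial_lift_refine FM proj (@depH_pro _ _ _ E) e_hom Rlift h1.
  exact/nR'h/(Rmin R').
have [th [thH Rth]] := partial_lift_graph Rlift R1.
exists th; split=> // [x|g].
  exact: lift_fiber Rlift _ _ (Rth x).
(* [R] contains both [(g, e g)] and [(g, th g)], so their quotient lies over [1] and is trivial. *)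
apply: (@mulgI _ (e g)^-1); rewrite mulVg; apply: R1.
rewrite -(mulVg (set_val g)); apply: (liftM Rlift) => //.
by apply: (liftV Rlift); exact: lift_graph Rlift g.
Qed.
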